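(* Let $(X,d)$ be a complete metric space equipped with a doubling measure $\mu$. Assume that $(X,d,\mu)$ satisfies the following annular decay property: for every $\eta>0$ there exists $\varepsilon\in(0,1)$ such that $$\sup_{x\in X,\ 0<t\le s,\ 1-\frac ts\le\varepsilon}\frac{\mu\big(B(x,s)\setminus B(x,t)\big)}{\mu(B(x,s))}<\eta .$$ Let $E\subset X$ be a subset. Then the following statements are equivalent: (A') $E$ is weakly porous. (B') There exists $\alpha>0$ for which $\operatorname{dist}(\cdot,E)^{-\alpha}\in A_1(X)$.
   Context: Setting: $(X,d)$ is a complete metric space, $B(x,r)=\{y\in X: d(x,y)<r\}$, and $\mu$ is a complete Borel regular measure on $X$ for which there is a constant $C_\mu>0$ with $0<\mu(B(x,2r))\le C_\mu\,\mu(B(x,r))<\infty$ for all $x\in X$, $r>0$. Balls are open and come with a prescribed center and radius. $\operatorname{dist}(x,E)=\inf\{d(x,y):y\in E\}$ (with $\inf\emptyset=+\infty$), and for $\alpha>0$, $\operatorname{dist}(x,E)^{-\alpha}=+\infty$ when $\operatorname{dist}(x,E)=0$. Maximal $E$-free hole: for a ball $B=B(x,R)$, $h_E(B)=\sup\{0<r\le 2R:\ \text{there exists } y\in X \text{ with } B(y,r)\subset B(x,R)\setminus E\}$, with $h_E(B)=0$ if there is no such $r$. Weak porosity: $E$ is weakly porous if there are constants $c,\delta\in(0,1)$ such that for every ball $B=B(x,R)\subset X$ there is a finite collection of mutually disjoint open balls $B_i=B(x_i,r_i)$, $i=1,\dots,N$, contained in $B\setminus E$, with $\delta h_E(B)\le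 r_i\le 2R$ for every $i$ and $\sum_{i=1}^N\mu(B_i)\ge c\,\mu(B)$. A weight is a nonnegative locally integrable function $w$ on $X$. A weight $w$ belongs to $A_1(X)$ if there is a constant $C\ge0$ with $\frac1{\mu(B)}\int_B w\,d\mu\le C\operatorname{ess\,inf}_{B}w$ for every ball $B\subset X$. *)

(* Defs.v *)
From HB Require Import structures.
From mathcomp Require Import all_boot all_order all_algebra.
From mathcomp Require Import all_classical all_reals all_analysis.
From mathcomp Require Import measurable_realfun.

Set Implicit Arguments.
Unset Strict Implicit.
Unset Printing Implicit Defensive.

Import Order.TTheory GRing.Theory Num.Theory.
Import numFieldNormedType.Exports.

Local Open Scope classical_set_scope.
Local Open Scope ring_scope.

(* No compatibility between the topology and the sigma-algebra is built in;
   it is part of [borel_regular] below. *)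
#[short(type="completeMetricMeasurableType")]
HB.structure Definition CompleteMetricMeasurable d (R : numDomainType) :=
  {T of Measurable d T & Metric R T & Complete T}.

Section definitions.
Context {d : measure_display} {R : realType}
  {X : completeMetricMeasurableType d R}.
Implicit Types (mu : {measure set X -> \bar R}) (E : set X) (x y : X).
Implicit Types (w : X -> \bar R).

Definition borel_regular mu : Prop :=
  (forall U : set X, open U -> measurable U) /\
  (forall A : set X, measurable A ->
    exists G : set X, [/\ <<s @open X >> G, A `<=` G & mu G = mu A]).

Definition doubling mu : Prop :=
  exists C : R, 0 < C /\ forall x (r : R), 0 < r ->
    (0 < mu (ball x (2 * r)) /\
     mu (ball x (2 * r)) <= C%:E * mu (ball x r) /\
     C%:E * mu (ball x r) < +oo)%E.

Definition annular_decay mu : Prop :=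
  forall eta : R, 0 < eta -> exists eps : R, 0 < eps < 1 /\
    (ereal_sup [set q | exists x (s t : R),
        [/\ (0 < t)%R, (t <= s)%R, (1 - t / s <= eps)%R &
            q = mu (ball x s `\` ball x t) / mu (ball x s)]] < eta%:E)%E.

(* [sup set0 = 0], as required when there is no admissible radius. *)
Definition maximal_hole E x (r : R) : R :=
  sup [set s : R | 0 < s <= 2 * r /\
                   exists y, ball y s `<=` ball x r `\` E].

(* [0 < rs i] is explicit since [delta * maximal_hole E x r] may be 0. *)
Definition weakly_porous mu E : Prop :=
  exists c delta : R, [/\ 0 < c < 1, 0 < delta < 1 &
    forall x (r : R), 0 < r ->
    exists (N : nat) (xs : 'I_N -> X) (rs : 'I_N -> R),
      [/\ forall i, 0 < rs i,
          trivIset [set: 'I_N] (fun i => ball (xs i) (rs i)),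
          forall i, ball (xs i) (rs i) `<=` ball x r `\` E,
          forall i, delta * maximal_hole E x r <= rs i <= 2 * r &
          (c%:E * mu (ball x r) <= \sum_(i < N) mu (ball (xs i) (rs i)))%E]].

Definition dist_set E x : \bar R := ereal_inf [set (mdist x y)%:E | y in E].

(* The inverse is taken outside the power because [powR 0 (- alpha) = 0] and
   [poweR +oo (- alpha) = +oo], whereas in [\bar R] [0^-1 = +oo] and
   [+oo^-1 = 0]. *)
Definition dist_negpow E (alpha : R) x : \bar R :=
  ((dist_set E x `^ alpha)^-1)%E.

Definition weight mu w : Prop :=
  [/\ forall x, (0 <= w x)%E,
      measurable_fun [set: X] w &
      forall x, exists2 r : R, 0 < r & mu.-integrable (ball x r) w].

Definition ess_inf_on mu (B : set X) w : \bar R :=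
  ereal_sup [set m : \bar R | \forall x \ae mu, B x -> (m <= w x)%E].

Definition muckenhoupt_A1 mu w : Prop :=
  weight mu w /\
  exists C : R, 0 <= C /\ forall x (r : R), 0 < r ->
    ((mu (ball x r))^-1 * \int[mu]_(y in ball x r) w y
       <= C%:E * ess_inf_on mu (ball x r) w)%E.

End definitions.

(* Main.v *)
(* Porosity implies A1.  Annular decay makes the maximal hole [h x r] doubling in [r]: if it
   shrank abruptly, the porosity balls would concentrate in a thin annulus.  Fix a ball with
   hole size H.  For a point x close to E choose the scale r at which [h x r] is comparable to
   a level tau < H; the porosity balls of [ball x r] show that a fixed fraction of that ball is
   at distance >= delta tau / 2 from E, whereas the whole ball stays within a multiple of tau
   of E.  A Vitali covering then gives geometric decay of mu {dist(., E) < theta^k H} in k,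
   and summing over layers bounds the mean of dist(., E)^-alpha by a multiple of H^-alpha for
   small alpha, while dist(., E) is at most a multiple of H on the ball.
   Conversely, A1 forces {dist(., E) < beta h} to have small measure in a ball with hole size
   h; removing also a thin annulus and applying Vitali with a constant radius comparable to h
   yields the porosity balls. *)

Require Import Defs.
From HB Require Import structures.
From mathcomp Require Import all_boot all_order all_algebra.
From mathcomp Require Import all_classical all_reals all_analysis.
From mathcomp Require Import measurable_realfun.
From mathcomp Require Import ring lra.

Set Implicit Arguments.
Unset Strict Implicit.
Unset Printing Implicit Defensive.

Import Order.TTheory GRing.Theory Num.Theory.
Import numFieldNormedType.Exports.

Local Open Scope classical_set_scope.
Local Open Scope ring_scope.

(** * Finite Vitali selection *)

Section metric_balls.
Context {R : realType} {X : metricType R}.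
Implicit Types (x y z : X) (r s : R).

Lemma in_ballE x r y : ball x r y = (mdist x y < r).
Proof. by rewrite ballEmdist. Qed.

Lemma ball_subset x y r s : mdist x y + s <= r -> ball y s `<=` ball x r.
Proof.
move=> h z; rewrite !in_ballE => yz; apply: lt_le_trans h.
by apply: le_lt_trans (metric_triangle x y z) _; rewrite ltrD2l.
Qed.

Lemma ball_open_metric x r : open (ball x r).
Proof.
rewrite openE => y; rewrite /interior/= in_ballE => xy.
apply/nbhs_ballP; exists (r - mdist x y) => /=; first by rewrite subr_gt0.
by apply: ball_subset; rewrite addrC subrK.
Qed.

Definition disjoint_balls (rad : X -> R) : rel X :=
  fun x y => `[< ball x (rad x) `&` ball y (rad y) = set0 >].

(** Greedy selection, by induction on the bound [n] for the length of disjoint families. After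
    picking [x] with nearly maximal radius, a disjoint family among the balls missing
    [ball x (rad x)] can be extended by [x], so the bound drops by one. A ball meeting
    [ball x (rad x)] has radius at most [2 * rad x], so its center is within [3 * rad x]. Only
    centers are covered, hence 3 and not 5. *)
Lemma finite_vitali_selection (rad : X -> R) (M : R) (n : nat) (A : set X) :
  (forall x, A x -> 0 < rad x <= M) ->
  (forall s : seq X, {in s, forall x, A x} ->
     pairwise (disjoint_balls rad) s -> (size s <= n)%N) ->
  exists s : seq X, [/\ {in s, forall x, A x},
    pairwise (disjoint_balls rad) s &
    forall x, A x -> exists2 y, y \in s & mdist y x < 3 * rad y].
Proof.
elim: n A => [|n IH] A radA sizeA.
  exists [::]; split=> // x Ax.
  suff : (size [:: x] <= 0)%N by [].
  by apply: sizeA => // y; rewrite inE => /eqP ->.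
have [[x0 Ax0]|A0] := pselect (exists x, A x); last first.
  by exists [::]; split=> // x Ax; case: A0; exists x.
(* The supremum of the radii may not be attained; a radius above half of it suffices. *)
have {x0 Ax0} [x Ax xmax] : exists2 x, A x & forall y, A y -> rad y <= 2 * rad x.
  have hs : has_sup [set rad x | x in A].
    split; first by exists (rad x0); exists x0.
    by exists M => _ [y Ay <-]; case/andP: (radA y Ay).
  have sup0 : 0 < sup [set rad x | x in A].
    have /andP[r0 _] := radA _ Ax0.
    by apply: lt_le_trans r0 _; apply: ub_le_sup; [case: hs|exists x0].
  have [_ [x Ax <-] xs] := sup_adherent (divr_gt0 sup0 (ltr0n _ 2)) hs.
  exists x => // y Ay.
  have : rad y <= sup [set rad x | x in A].
    by apply: ub_le_sup; [case: hs|exists y].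
  by move: xs; lra.
pose A' := A `&` [set y | disjoint_balls rad x y].
have [||s [sA' sd sc]] := IH A'.
- by move=> y [Ay _]; exact: radA.
- move=> s sA' sd; have := sizeA (x :: s); rewrite /= ltnS; apply.
    by move=> y; rewrite inE => /orP[/eqP ->//|/sA'[]].
  by rewrite sd andbT; apply/allP => y /sA'[].
exists (x :: s); split.
- by move=> y; rewrite inE => /orP[/eqP ->//|/sA'[]].
- by rewrite /= sd andbT; apply/allP => y /sA'[].
move=> y Ay; have [xy|/asboolP/eqP/set0P[z [xz yz]]] := boolP (disjoint_balls rad x y).
  have [z zs zy] := sc y (conj Ay xy).
  by exists z => //; rewrite inE zs orbT.
exists x; first by rewrite mem_head.
move: xz yz; rewrite !in_ballE (metric_sym y).
have := metric_triangle x z y; have := xmax _ Ay; lra.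
Qed.

End metric_balls.

(** * Measures of disjoint and of covering finite families *)

Section measure_sums.
Context {d : measure_display} {R : realType} {T : measurableType d}.
Variable mu : {measure set T -> \bar R}.
Local Open Scope ereal_scope.

Lemma measure_subset (A B : set T) :
  measurable A -> measurable B -> A `<=` B -> mu A <= mu B.
Proof. by move=> mA mB AB; apply: le_measure => //; rewrite inE. Qed.

Lemma sum_disjoint_le (I : eqType) (F : I -> set T) (s : seq I) (D : set T) :
  (forall i, measurable (F i)) -> measurable D ->
  pairwise (fun i j => `[< F i `&` F j = set0 >]) s ->
  {in s, forall i, F i `<=` D} ->
  \sum_(i <- s) mu (F i) <= mu D.
Proof.
move=> mF; elim: s D => [|i s IH] D mD; first by rewrite big_nil.
move=> /= /andP[/allP/= Fi Fs] sD; rewrite big_cons.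
rewrite (measureDI mu mD (mF i)) addeC; apply: leeD.
  apply: IH => //; first exact: measurableD.
  move=> j js z Fjz; split; first by apply: (sD j) => //; rewrite inE js orbT.
  by move=> Fiz; have /asboolP := Fi _ js; apply/eqP/set0P; exists z.
apply: measure_subset => //; first exact: measurableI.
by move=> z Fz; split=> //; apply: (sD i) => //; rewrite mem_head.
Qed.

Lemma measure_le_cover (I : eqType) (F : I -> set T) (s : seq I) (A : set T) :
  (forall i, measurable (F i)) -> measurable A ->
  (forall x, A x -> exists2 i, i \in s & F i x) ->
  mu A <= \sum_(i <- s) mu (F i).
Proof.
move=> mF; elim: s A => [|i s IH] A mA As.
  rewrite (_ : A = set0) ?measure0 ?big_nil//.
  by apply/seteqP; split=> // x /As[].
rewrite big_cons (measureDI mu mA (mF i)) addeC; apply: leeD.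
  by apply: measure_subset => //; exact: measurableI.
apply: IH; first exact: measurableD.
move=> x [/As[j + Fj] Fi]; rewrite inE => /orP[/eqP ji|js]; last by exists j.
by rewrite -ji in Fi.
Qed.

End measure_sums.

(** * Doubling with an explicit constant, and the resulting covering lemma *)

Definition doubling_const {d : measure_display} {R : realType}
    {X : completeMetricMeasurableType d R} (mu : {measure set X -> \bar R})
    (C : R) : Prop :=
  forall (x : X) (r : R), 0 < r ->
  (0 < mu (ball x (2 * r)) /\
   mu (ball x (2 * r)) <= C%:E * mu (ball x r) /\
   C%:E * mu (ball x r) < +oo)%E.

Section doubling_measure.
Context {d : measure_display} {R : realType}.
Context {X : completeMetricMeasurableType d R}.
Variables (mu : {measure set X -> \bar R}) (C : R).
Hypothesis open_measurable_set : forall U : set X, open U -> measurable U.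
Hypothesis C_gt0 : 0 < C.
Hypothesis doublingC : doubling_const mu C.

Implicit Types (x : X) (r : R).

Lemma measurable_ball_metric x r : measurable (ball x r).
Proof. exact/open_measurable_set/ball_open_metric. Qed.
Hint Resolve measurable_ball_metric : core.

Lemma measure_ball_gt0 x r : 0 < r -> (0 < mu (ball x r))%E.
Proof.
move=> r0; have [] := @doublingC x (r / 2); first by rewrite divr_gt0.
by rewrite mulrC divfK.
Qed.

Lemma measure_ball_fin_num x r : 0 < r -> mu (ball x r) \is a fin_num.
Proof.
move=> r0; have [_ [_]] := doublingC x r0; rewrite ge0_fin_numE//.
by case: (mu _) => [t _|+|//]; rewrite ?ltry// mulry gtr0_sg// mul1e.
Qed.

Lemma measure_ball_double x r : 0 < r ->
  (mu (ball x (2 * r)) <= C%:E * mu (ball x r))%E.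
Proof. by move=> r0; have [_ []] := doublingC x r0. Qed.

Lemma measure_ball_half x r : 0 < r ->
  (mu (ball x r) <= C%:E * mu (ball x (r / 2)))%E.
Proof.
move=> r0; rewrite {1}(_ : r = 2 * (r / 2)); last by rewrite mulrC divfK.
by apply: measure_ball_double; rewrite divr_gt0.
Qed.

Lemma measure_ball_pow2 x r n : 0 < r ->
  (mu (ball x (2 ^+ n * r)) <= (C ^+ n)%:E * mu (ball x r))%E.
Proof.
move=> r0; elim: n => [|n IH]; first by rewrite !expr0 mul1r mul1e.
rewrite exprS -mulrA; apply: le_trans (measure_ball_double _ _) _.
  by rewrite mulr_gt0// exprn_gt0.
by rewrite exprS EFinM -muleA lee_pmul2l.
Qed.

(** The lower bound [a] on the radii gives every ball a fixed fraction of the mass of [ball x0 R0],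
    so disjoint families have bounded length and the finite selection applies. Enlarging the
    selected balls to cover [A] costs two doublings. *)
Lemma doubling_vitali_cover x0 (R0 a M : R) (rad : X -> R) (A : set X) :
  measurable A -> 0 < R0 -> 0 < a ->
  (forall x, A x -> a <= rad x <= M) ->
  (forall x, A x -> ball x (rad x) `<=` ball x0 R0) ->
  exists s : seq X, [/\ {in s, forall x, A x},
    pairwise (disjoint_balls rad) s &
    (mu A <= (C ^+ 2)%:E * \sum_(y <- s) mu (ball y (rad y)))%E].
Proof.
move=> mA R00 a0 arad Asub.
have rad0 x : A x -> 0 < rad x by move=> /arad/andP[+ _]; exact: lt_le_trans.
(* The centers lie in [ball x0 R0], so a radius of [2 * R0] around any of them captures that ball;
   [n] doublings of [a] reach it. *)
have [n nP] : exists n, R0 + R0 <= 2 ^+ n * a.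
  exists (Num.bound ((R0 + R0) / a)); rewrite -ler_pdivrMr//.
  have : 0 <= (R0 + R0) / a by rewrite divr_ge0 ?addr_ge0// ltW.
  move=> /archi_boundP/lt_trans xb; apply/ltW/xb.
  by rewrite -natrX ltr_nat ltn_expl.
pose m := fine (mu (ball x0 R0)).
have mE : m%:E = mu (ball x0 R0) by rewrite fineK// measure_ball_fin_num.
have m0 : 0 < m by rewrite -lte_fin mE measure_ball_gt0.
have big x : A x -> ((m / C ^+ n)%:E <= mu (ball x (rad x)))%E.
  move=> Ax; rewrite mulrC EFinM lee_pdivrMl ?exprn_gt0// mE.
  apply: (@le_trans _ _ (mu (ball x (2 ^+ n * rad x)))).
    apply: measure_subset => //; apply: ball_subset.
    have := Asub x Ax x; rewrite !in_ballE mdistxx metric_sym => /(_ (rad0 x Ax)) xx0.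
    have /andP[ax _] := arad x Ax.
    have : 2 ^+ n * a <= 2 ^+ n * rad x by rewrite ler_pM2l// exprn_gt0.
    by move: nP xx0; lra.
  exact: measure_ball_pow2 (rad0 x Ax).
have sum_le (s : seq X) : {in s, forall x, A x} ->
    pairwise (disjoint_balls rad) s ->
    (\sum_(y <- s) mu (ball y (rad y)) <= mu (ball x0 R0))%E.
  move=> sA sd; apply: (@sum_disjoint_le _ _ _ mu X (fun y => ball y (rad y))) => //.
  by move=> y /sA/Asub.
have [|s sA sd|s [sA sd sc]] :=
    @finite_vitali_selection _ _ rad M (Num.bound (C ^+ n)) A.
- by move=> x Ax; have /andP[_ ->] := arad x Ax; rewrite rad0.
- have := sum_le s sA sd.
  have : ((m / C ^+ n *+ size s)%:E <= \sum_(y <- s) mu (ball y (rad y)))%E.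
    elim: s sA {sd} => [|y s IH] sA; first by rewrite big_nil.
    rewrite big_cons /= mulrS EFinD; apply: leeD.
      by apply/big/sA; rewrite mem_head.
    by apply: IH => z zs; apply: sA; rewrite inE zs orbT.
  move=> /le_trans/[apply]; rewrite -mE lee_fin -mulr_natr mulrAC.
  rewrite ler_pdivrMr ?exprn_gt0// ler_pM2l// => sC.
  rewrite ltnW// -(ltr_nat R); apply: le_lt_trans sC _.
  by rewrite archi_boundP// exprn_ge0// ltW.
exists s; split=> //.
rewrite ge0_sume_distrr//.
(* The factor 3 of the selection is rounded up to [2 ^+ 2]. *)
apply: le_trans (@measure_le_cover _ _ _ mu X (fun y => ball y (2 ^+ 2 * rad y)) s A _ _ _) _ => //.
  move=> x Ax; have [y ys xy] := sc x Ax; exists y => //; rewrite in_ballE.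
  apply: lt_le_trans xy _; have := rad0 _ (sA y ys); lra.
rewrite big_seq [leRHS]big_seq; apply: lee_sum => y ys.
exact/measure_ball_pow2/rad0/sA.
Qed.

End doubling_measure.

(** * Tubes and maximal holes *)

Section holes.
Context {d : measure_display} {R : realType}.
Context {X : completeMetricMeasurableType d R}.
Implicit Types (x y z : X) (r s t : R) (E : set X).

(** The sublevel set {dist(., E) < t}, written with a witness instead of an infimum; it is empty
    when [E] is. *)
Definition tube E t : set X := [set x | exists2 y, E y & mdist x y < t].

Lemma tube_open E t : open (tube E t).
Proof.
rewrite openE => x [y Ey xy]; apply/nbhs_ballP; exists (t - mdist x y) => /=.
  by rewrite subr_gt0.
move=> z; rewrite in_ballE => xz; exists y => //.
by have := metric_triangle z x y; rewrite (metric_sym z x); move: xz; lra.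
Qed.

Lemma tubeS E s t : s <= t -> tube E s `<=` tube E t.
Proof. by move=> st x [y Ey /lt_le_trans xy]; exists y => //; exact: xy. Qed.

Lemma tube_shift E t x z : tube E t x -> tube E (mdist x z + t) z.
Proof.
move=> [y Ey xy]; exists y => //.
by have := metric_triangle z x y; rewrite (metric_sym z x); lra.
Qed.

Lemma not_tubeP E t x : ~ tube E t x <-> ball x t `<=` ~` E.
Proof.
split=> [nt y + Ey|bE [y Ey xy]]; first by rewrite in_ballE => xy; apply: nt; exists y.
by apply: (bE y) => //; rewrite in_ballE.
Qed.

Lemma dist_set_ltP E t x : (dist_set E x < t%:E)%E <-> tube E t x.
Proof.
split=> [/ereal_inf_ltP[_ [y Ey <-]]|[y Ey xy]]; first by rewrite lte_fin; exists y.
by apply/ereal_inf_ltP; exists (mdist x y)%:E; [exists y|rewrite lte_fin].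
Qed.

Lemma dist_set_ge0 E x : (0 <= dist_set E x)%E.
Proof. by apply: le_ereal_inf_tmp => _ [y _ <-]; rewrite lee_fin mdist_ge0. Qed.

Let holes E x r :=
  [set s : R | 0 < s <= 2 * r /\ exists y, ball y s `<=` ball x r `\` E].

Let holes_ub E x r : has_ubound (holes E x r).
Proof. by exists (2 * r) => s [/andP[]]. Qed.

Lemma hole_ge E x y r s :
  0 < s <= 2 * r -> ball y s `<=` ball x r `\` E -> s <= maximal_hole E x r.
Proof. by move=> sr ys; apply: (ub_le_sup (holes_ub E x r)); split=> //; exists y. Qed.

Lemma hole_le_bound E x r b : 0 <= b ->
  (forall y s, 0 < s <= 2 * r -> ball y s `<=` ball x r `\` E -> s <= b) ->
  maximal_hole E x r <= b.
Proof.
move=> b0 hb; change (sup (holes E x r) <= b).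
have [->|/set0P holesN0] := eqVneq (holes E x r) set0; first by rewrite sup0.
by apply: ge_sup => // s [sr [y ys]]; exact: hb ys.
Qed.

Lemma hole_ge0 E x r : 0 <= maximal_hole E x r.
Proof.
change (0 <= sup (holes E x r)).
have [->|/set0P[s hs]] := eqVneq (holes E x r) set0; first by rewrite sup0.
have [/andP[s0 _] _] := hs; apply: le_trans (ltW s0) _.
exact: (ub_le_sup (holes_ub E x r)).
Qed.

Lemma hole_le E x r : 0 <= r -> maximal_hole E x r <= 2 * r.
Proof. by move=> r0; apply: hole_le_bound => [|y s /andP[]//]; rewrite mulr_ge0. Qed.

(** The inequality [s <= r] is separate from the inclusion because a ball as a set does not
    determine its radius, and the radius caps the admissible holes. *)
Lemma hole_mono E x y r s : s <= r -> ball y s `<=` ball x r ->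
  maximal_hole E y s <= maximal_hole E x r.
Proof.
move=> sr yx; apply: hole_le_bound; first exact: hole_ge0.
move=> z t /andP[t0 ts] zt; apply: (@hole_ge _ _ z); first by rewrite t0; lra.
by move=> u /zt[/yx].
Qed.

Lemma hole_gt E x r t : 0 <= t < maximal_hole E x r ->
  exists y s, [/\ t < s, s <= 2 * r & ball y s `<=` ball x r `\` E].
Proof.
move=> /andP[t0 th]; apply: contrapT => no.
move: th; rewrite ltNge => /negP; apply.
apply: hole_le_bound => // y s /andP[s0 sr] ys; rewrite leNgt; apply/negP => ts.
by apply: no; exists y, s.
Qed.

End holes.

(** * Annular decay without quotients *)

Section annular.
Context {d : measure_display} {R : realType}.
Context {X : completeMetricMeasurableType d R}.
Variables (mu : {measure set X -> \bar R}).
Implicit Types (x y z : X) (r s t : R).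
Hypothesis ball_fin_num : forall x r, 0 < r -> mu (ball x r) \is a fin_num.
Hypothesis ball_gt0 : forall x r, 0 < r -> (0 < mu (ball x r))%E.

Lemma annular_decay_le (eta : R) : annular_decay mu -> 0 < eta ->
  exists eps : R, 0 < eps < 1 /\ forall x s t, 0 < t <= s -> (1 - eps) * s <= t ->
    (mu (ball x s `\` ball x t) < eta%:E * mu (ball x s))%E.
Proof.
move=> ad /ad[eps [eps01 supeta]]; exists eps; split=> // x s t /andP[t0 ts] st.
have s0 : 0 < s by exact: lt_le_trans ts.
have [m mE] : exists m, mu (ball x s) = m%:E.
  by exists (fine (mu (ball x s))); rewrite fineK// ball_fin_num.
have m0 : 0 < m by rewrite -lte_fin -mE ball_gt0.
have : (mu (ball x s `\` ball x t) / mu (ball x s) < eta%:E)%E.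
  apply: le_lt_trans supeta; apply: ereal_sup_ubound.
  exists x, s, t; split=> //; rewrite lerBlDl -lerBlDr ler_pdivlMr//.
by rewrite mE inver gt_eqF// lte_pdivrMr.
Qed.

End annular.

(** * Holes of weakly porous sets, with explicit porosity constants *)

Definition porous_const {d : measure_display} {R : realType}
    {X : completeMetricMeasurableType d R} (mu : {measure set X -> \bar R})
    (E : set X) (c delta : R) : Prop :=
  forall (x : X) (r : R), 0 < r ->
  exists (N : nat) (xs : 'I_N -> X) (rs : 'I_N -> R),
    [/\ forall i, 0 < rs i,
        trivIset [set: 'I_N] (fun i => ball (xs i) (rs i)),
        forall i, ball (xs i) (rs i) `<=` ball x r `\` E,
        forall i, delta * maximal_hole E x r <= rs i <= 2 * r &
        (c%:E * mu (ball x r) <= \sum_(i < N) mu (ball (xs i) (rs i)))%E].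

Section porous_holes.
Context {d : measure_display} {R : realType}.
Context {X : completeMetricMeasurableType d R}.
Variables (mu : {measure set X -> \bar R}) (C : R).
Hypothesis open_measurable_set : forall U : set X, open U -> measurable U.
Hypothesis C_gt0 : 0 < C.
Hypothesis doublingC : doubling_const mu C.
Variables (E : set X) (c delta : R).
Hypotheses (c_gt0 : 0 < c) (delta_gt0 : 0 < delta).
Hypothesis porousE : porous_const mu E c delta.
Implicit Types (x y z : X) (r s t : R).
Local Notation h := (maximal_hole E).
Local Notation measurable_ball := (measurable_ball_metric open_measurable_set).

(** An empty family cannot carry the positive mass [c * mu (ball x r)], so there is a porosity ball,
    and its radius is admissible for the hole. *)
Lemma maximal_hole_gt0 x r : 0 < r -> 0 < h x r.
Proof.
move=> r0; have [[|N] [xs [rs [rs0 _ sub rsb cov]]]] := porousE x r0.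
  by move: cov; rewrite big_ord0 leNgt mule_gt0// (measure_ball_gt0 doublingC).
have [/andP[_ rsr] rpos] := (rsb ord0, rs0 ord0).
by apply: (lt_le_trans rpos); apply: hole_ge (sub ord0); rewrite rpos.
Qed.

(** Halving the porosity balls costs one doubling constant, and points of the half balls keep a
    distance from [E]. This locates a fixed fraction of the mass in any [D] that contains all half
    balls. *)
Lemma porous_half_balls x r (D : set X) : 0 < r -> measurable D ->
  (forall y s, 0 < s -> delta * h x r <= s -> ball y s `<=` ball x r `\` E ->
     ball y (s / 2) `<=` D) ->
  (c%:E * mu (ball x r) <= C%:E * mu D)%E.
Proof.
move=> r0 mD halfD; have [N [xs [rs [rs0 triv sub rsb cov]]]] := porousE x r0.
apply: le_trans cov _.
apply: (@le_trans _ _ (C%:E * \sum_(i < N) mu (ball (xs i) (rs i / 2)))%E).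
  rewrite ge0_sume_distrr//; apply: lee_sum => i _.
  exact: (measure_ball_half doublingC).
rewrite lee_pmul2l ?lte_fin//.
apply: (@sum_disjoint_le _ _ _ mu 'I_N (fun i => ball (xs i) (rs i / 2))) => //.
- by move=> i; exact: measurable_ball.
- have := index_enum_uniq 'I_N; rewrite uniq_pairwise.
  apply: sub_pairwise => i j ij.
  apply/asboolP/eqP/negPn/negP => /set0P[z [zi zj]].
  move/trivIsetP: triv => /(_ i j I I ij) /eqP/negPn/negP; apply; apply/set0P.
  exists z; split.
    apply: (@ball_subset _ _ (xs i) (xs i) (rs i) (rs i / 2)) => //.
      by rewrite mdistxx add0r; have := rs0 i; lra.
  apply: (@ball_subset _ _ (xs j) (xs j) (rs j) (rs j / 2)) => //.
    by rewrite mdistxx add0r; have := rs0 j; lra.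
- move=> i _; apply: halfD (sub i) => //; by have /andP[] := rsb i.
Qed.

(** If the hole of the slightly smaller ball were too small, no half porosity ball could reach into
    [ball x ((1 - eps) * t)]. All of them would lie in an annulus of relative mass below [c / C],
    against [porous_half_balls]. *)
Lemma hole_step : annular_decay mu -> exists lam kap : R,
  [/\ 0 < lam < 1, 0 < kap < 1 &
      forall x t, 0 < t -> kap * h x t <= h x (lam * t)].
Proof.
have delta1 := delta_gt0; have fin := measure_ball_fin_num C_gt0 doublingC.
have pos := measure_ball_gt0 doublingC.
move=> /(annular_decay_le fin pos)/(_ (divr_gt0 c_gt0 C_gt0))[eps [/andP[e0 e1] ann]].
exists (1 - eps / 2), (Num.min (delta / 2) (eps / 4)); split.
- by apply/andP; split; lra.
- by rewrite lt_min gt_min; apply/andP; split; [apply/andP; split|apply/orP; right]; lra.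
move=> x t t0; rewrite leNgt; apply/negP => hlt.
have h0 := maximal_hole_gt0 x t0; have ht := hole_le E x (ltW t0).
(* [rho] is at most half the radius of every porosity ball, so balls of radius [rho] around points
   of half balls avoid [E]. It is also at most [eps * t / 2], so around points of
   [ball x ((1 - eps) * t)] they stay in the ball of radius [(1 - eps / 2) * t]. The two terms of
   [kap] match the two terms of [rho], using [h x t <= 2 * t]. *)
pose rho := Num.min (delta * h x t / 2) (eps * t / 2).
have rho1 : rho <= delta * h x t / 2 by rewrite ge_min lexx.
have rho2 : rho <= eps * t / 2 by rewrite ge_min lexx orbT.
have rho0 : 0 < rho by rewrite lt_min; apply/andP; split; rewrite divr_gt0// mulr_gt0.
have et : eps * t < t by rewrite gtr_pMl.
have hrho : h x ((1 - eps / 2) * t) < rho.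
  apply: lt_le_trans hlt _; rewrite le_min; apply/andP; split.
    by rewrite mulrAC ler_pM2r// ge_min lexx.
  apply: (@le_trans _ _ (eps / 4 * h x t)); first by rewrite ler_pM2r// ge_min lexx orbT.
  have : eps * h x t <= eps * (2 * t) by rewrite ler_pM2l.
  lra.
suff : (c%:E * mu (ball x t) < c%:E * mu (ball x t))%E by rewrite ltxx.
have t1 : 0 < (1 - eps) * t by rewrite mulr_gt0// subr_gt0.
apply: (@le_lt_trans _ _ (C%:E * mu (ball x t `\` ball x ((1 - eps) * t)))%E).
  apply: porous_half_balls => //; first by apply: measurableD; exact: measurable_ball.
  move=> y s s0 sh ysub z yz; split.
    have [] // := ysub z; move: yz; rewrite !in_ballE; lra.
  rewrite in_ballE => xz; move: hrho; rewrite ltNge => /negP; apply.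
  apply: (@hole_ge _ _ _ _ _ z); first by rewrite rho0; lra.
  move=> u; rewrite !in_ballE => zu; split.
    have := metric_triangle x z u; rewrite in_ballE; lra.
  have [] // := ysub u; move: yz; rewrite !in_ballE.
  have := metric_triangle y z u; lra.
have -> : (c%:E * mu (ball x t) = C%:E * ((c / C)%:E * mu (ball x t)))%E.
  by rewrite muleA -EFinM mulrC divfK// gt_eqF.
rewrite lte_pmul2l//; apply: ann => //; rewrite t1 /=; lra.
Qed.

(** Iterates [hole_step] until the radius is at most [t / 2], then enlarges it to [t / 2] by
    monotonicity of the hole. *)
Lemma hole_half : annular_decay mu -> exists kap : R,
  0 < kap < 1 /\ forall x t, 0 < t -> kap * h x t <= h x (t / 2).
Proof.
move=> /hole_step[lam [kap [/andP[l0 l1] /andP[k0 k1] step]]].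
have [n nP] : exists n, lam ^+ n.+1 <= 2^-1.
  have : lam ^+ n @[n --> \oo] --> 0.
    by apply: cvg_expr; rewrite ger0_norm// ltW.
  move=> /cvgrPdist_le/(_ 2^-1); rewrite invr_gt0 ltr0n => /(_ isT)[n _ nP].
  exists n; have := nP n.+1 (leqnSn n); rewrite sub0r normrN ger0_norm//.
  by rewrite exprn_ge0// ltW.
exists (kap ^+ n.+1); split.
  by rewrite exprn_gt0//= exprn_ilt1// ltW.
move=> x t t0; apply: (@le_trans _ _ (h x (lam ^+ n.+1 * t))).
  elim: n.+1 => [|m IH]; first by rewrite !mul1r.
  rewrite !exprS -!mulrA; apply: le_trans (step _ _ _); last first.
    by rewrite mulr_gt0// exprn_gt0.
  by rewrite ler_pM2l.
have : lam ^+ n.+1 * t <= 2^-1 * t by rewrite ler_pM2r.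
rewrite mulrC [2^-1 * t]mulrC => le2; apply: hole_mono => //.
by apply: ball_subset; rewrite mdistxx add0r.
Qed.

End porous_holes.

(** * Decay of the measure of tubes *)

Section tube_decay.
Context {d : measure_display} {R : realType}.
Context {X : completeMetricMeasurableType d R}.
Variables (mu : {measure set X -> \bar R}) (C : R).
Hypothesis open_measurable_set : forall U : set X, open U -> measurable U.
Hypothesis C_gt0 : 0 < C.
Hypothesis doublingC : doubling_const mu C.
Variables (E : set X) (c delta kap : R).
Hypotheses (c_gt0 : 0 < c) (delta01 : 0 < delta < 1) (kap01 : 0 < kap < 1).
Hypothesis porousE : porous_const mu E c delta.
Local Notation h := (maximal_hole E).
Hypothesis hole_halfE : forall (x : X) (t : R), 0 < t -> kap * h x t <= h x (t / 2).
Implicit Types (x y z : X) (r s t tau rho : R).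
Local Notation a := (delta / 2).

Let measurable_ball x r : measurable (ball x r).
Proof. exact: measurable_ball_metric. Qed.

Let measurable_tube t : measurable (tube E t).
Proof. exact/open_measurable_set/tube_open. Qed.

Let kap_gt0 : 0 < kap. Proof. by case/andP: kap01. Qed.
Let delta_gt0 : 0 < delta. Proof. by case/andP: delta01. Qed.

Lemma hole_pow2 x t j : 0 < t -> kap ^+ j * h x t <= h x (t / 2 ^+ j).
Proof.
move=> t0; elim: j => [|j IH]; first by rewrite !expr0 mul1r divr1.
rewrite exprS -mulrA; apply: (@le_trans _ _ (kap * h x (t / 2 ^+ j))).
  by rewrite ler_pM2l.
rewrite exprSr invfM mulrA; apply: hole_halfE.
by rewrite divr_gt0// exprn_gt0.
Qed.

(** [ball x0 r] lies in [ball x (4 * r)], and two halvings lead back to radius [r]. *)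
Lemma hole_near x0 x r : 0 < r -> ball x0 (3 * r) x ->
  kap ^+ 2 * h x0 r <= h x r.
Proof.
move=> r0; rewrite in_ballE metric_sym => xx0.
have r4 : 0 < 2 ^+ 2 * r by rewrite mulr_gt0.
have -> : r = (2 ^+ 2 * r) / 2 ^+ 2 by rewrite mulrAC divff// mul1r.
apply: le_trans (hole_pow2 _ _ r4); rewrite ler_pM2l ?exprn_gt0//.
rewrite mulrAC divff// mul1r.
by apply: hole_mono; [|apply: ball_subset]; lra.
Qed.

(* The scale at which [tube_decay_step] is applied around [x]: the holes of the ball are
   comparable to [tau], although its radius may be much larger than [tau]. *)
Lemma stopping_scale x r tau : 0 < r -> 0 < tau <= h x r ->
  exists j, tau <= h x (r / 2 ^+ j) /\ h x (r / 2 ^+ j / 2) < tau.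
Proof.
move=> r0 /andP[tau0 htau].
have ex : exists n, h x (r / 2 ^+ n) < tau.
  exists (Num.bound (2 * r / tau)).
  apply: le_lt_trans (hole_le _ _ _) _; first by rewrite divr_ge0 ?exprn_ge0// ltW.
  have : 0 <= 2 * r / tau by rewrite divr_ge0// ?mulr_ge0// ltW.
  move=> /archi_boundP; rewrite ltr_pdivrMr// mulrA ltr_pdivrMr ?exprn_gt0//.
  move=> /lt_le_trans; apply; rewrite mulrC ler_pM2l//.
  by rewrite -natrX ler_nat ltnW// ltn_expl.
have [[|n] nP nmin] := ex_minnP ex.
  by move: nP; rewrite expr0 divr1 ltNge htau.
exists n; split; last by rewrite -mulrA -invfM -exprSr.
by rewrite leNgt; apply/negP => /nmin; rewrite ltnn.
Qed.

(** A point [z] of the ball at distance at least [s] from [E] would be the center of a hole of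
    radius [Num.min s r] in [ball x (2 * r)]. Two halvings compare that hole with the one at radius
    [r / 2], so [Num.min s r < kap ^- 2 * tau]. *)
Lemma ball_subset_tube x r s tau : 0 < r -> h x (r / 2) < tau ->
  tube E (a * tau) x -> (a + kap ^- 2) * tau <= s -> ball x r `<=` tube E s.
Proof.
move=> r0 htau xE taus z xz; apply: contrapT => /not_tubeP zs.
have tau0 : 0 < tau by apply: le_lt_trans htau; exact: hole_ge0.
have s0 : 0 < s.
  by apply: lt_le_trans taus; rewrite mulr_gt0// addr_gt0 ?divr_gt0// invr_gt0 exprn_gt0.
have m0 : 0 < Num.min s r by rewrite lt_min s0.
have mh : Num.min s r <= h x (2 * r).
  apply: (@hole_ge _ _ _ _ _ z).
    by rewrite m0/=; apply: (@le_trans _ _ r); [rewrite ge_min lexx orbT|lra].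
  move=> u zu; split.
    apply: (@ball_subset _ _ x z) zu; move: xz; rewrite in_ballE.
    have : Num.min s r <= r by rewrite ge_min lexx orbT.
    by lra.
  apply: zs; move: zu; rewrite !in_ballE => /lt_le_trans; apply.
  by rewrite ge_min lexx.
have hm : Num.min s r < kap ^- 2 * tau.
  rewrite mulrC ltr_pdivlMr ?exprn_gt0// mulrC.
  apply: le_lt_trans htau; have r2 : 0 < 2 * r by rewrite mulr_gt0.
  apply: (@le_trans _ _ (kap ^+ 2 * h x (2 * r))); first by rewrite ler_pM2l// exprn_gt0.
  by rewrite (_ : r / 2 = (2 * r) / 2 ^+ 2) ?hole_pow2//; field.
have atau : 0 < a * tau by rewrite mulr_gt0// divr_gt0.
(* A small [s] contradicts its lower bound; if [r] is small, a point of [E] near [x] is within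
   [r + a * tau <= s] of [z]. *)
move: hm; rewrite gt_min => /orP[|rk]; first by rewrite mulrDl in taus; lra.
apply: (not_tubeP E s z).2 => //; apply: tubeS (tube_shift z xE).
by move: xz; rewrite in_ballE; rewrite mulrDl in taus; lra.
Qed.

(** Points in a half porosity ball are at distance at least [delta * tau / 2] from [E], which is the
    origin of the factor [a]. *)
Lemma porous_outside_tube x r tau : 0 < r -> tau <= h x r ->
  (c%:E * mu (ball x r) <= C%:E * mu (ball x r `\` tube E (a * tau)))%E.
Proof.
move=> r0 htau.
apply: (porous_half_balls open_measurable_set C_gt0 doublingC porousE r0).
  exact: measurableD.
move=> y s s0 sh ysub z yz; split.
  by have [] // := ysub z; move: yz; rewrite !in_ballE; lra.
apply/not_tubeP => u zu; have [] // := ysub u.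
have : delta * tau <= delta * h x r by rewrite ler_pM2l.
have := metric_triangle y z u; move: yz zu; rewrite !in_ballE; lra.
Qed.

(** The selected stopping balls carry [A] up to the factor [C ^+ 2], each keeps the fraction [c / C]
    of its mass off the small tube, and all lie in [A']. So [A] has at most [K] times the mass of
    the part of [A'] off the tube; since [A] and that part are disjoint in [A'], the ratio is
    [q = K / (1 + K)]. *)
Lemma tube_decay_step : exists q : R, 0 < q < 1 /\
  forall x0 rho (rho' : R) s tau, 0 < rho -> 0 < tau -> rho' <= rho ->
  (a + kap ^- 2) * tau <= s ->
  (forall x, tube E (a * tau) x -> ball x0 rho' x ->
    exists r, [/\ 0 < r, rho' + r <= rho, tau <= h x r & h x (r / 2) < tau]) ->
  (mu (tube E (a * tau) `&` ball x0 rho') <=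
     q%:E * mu (tube E s `&` ball x0 rho))%E.
Proof.
pose K := C ^+ 3 / c.
have K0 : 0 < K by rewrite divr_gt0// exprn_gt0.
exists (K / (1 + K)); split.
  by rewrite divr_gt0 ?addr_gt0//= ltr_pdivrMr ?addr_gt0// mul1r ltrDr.
move=> x0 rho rho' s tau rho0 tau0 rhole taus scale.
set A := tube E (a * tau) `&` ball x0 rho'; set A' := tube E s `&` ball x0 rho.
have mA : measurable A by exact: measurableI.
have mA' : measurable A' by exact: measurableI.
have /choice[rad radP] : forall x, exists r, A x ->
    [/\ 0 < r, rho' + r <= rho, tau <= h x r & h x (r / 2) < tau].
  move=> x; have [[xE xx0]|nA] := pselect (A x); last by exists 0 => /nA.
  by have [r rP] := scale x xE xx0; exists r.
have radball x : A x -> ball x (rad x) `<=` A'.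
  move=> Ax; have [r0 rr htau htau2] := radP x Ax; case: Ax => xE xx0.
  move=> z xz; split; first exact: (ball_subset_tube r0 htau2 xE taus).
  apply: ball_subset xz; move: xx0; rewrite in_ballE; lra.
(* The lower bound on the radii comes from [tau <= h x r <= 2 * r]. *)
have [|x Ax||s0 [sA sd sc]] :=
  doubling_vitali_cover open_measurable_set C_gt0 doublingC
    (x0 := x0) (a := tau / 2) (M := rho) (rad := rad) mA rho0.
- by rewrite divr_gt0.
- have [r0 rr htau htau2] := radP x Ax; have := hole_le E x (ltW r0).
  have [_] := Ax; rewrite in_ballE; have := mdist_ge0 x0 x.
  by move=> ? ? ?; apply/andP; split; lra.
- by move=> x /radball xA z /xA[].
have step : (mu A <= K%:E * mu (A' `\` tube E (a * tau)))%E.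
  apply: le_trans sc _.
  apply: (@le_trans _ _ ((C ^+ 2)%:E * ((C / c)%:E *
      \sum_(y <- s0) mu (ball y (rad y) `\` tube E (a * tau))))%E).
    rewrite lee_pmul2l ?lte_fin ?exprn_gt0// ge0_sume_distrr//.
    rewrite big_seq [leRHS]big_seq; apply: lee_sum => y ys.
    have [r0 _ htau _] := radP y (sA y ys).
    rewrite mulrC EFinM -muleA lee_pdivlMl//.
    exact: porous_outside_tube.
  rewrite muleA -EFinM mulrA -exprSr lee_pmul2l//.
  apply: (@sum_disjoint_le _ _ _ mu X (fun y => ball y (rad y) `\` tube E (a * tau))).
  - by move=> y; exact: measurableD.
  - exact: measurableD.
  - apply: sub_pairwise sd => y z /asboolP yz; apply/asboolP/eqP/negPn/negP.
    move=> /set0P[u [[yu _] [zu _]]].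
    by have : set0 u by rewrite -yz.
  - by move=> y ys z [yz zE]; split=> //; exact: (radball y (sA y ys)).
have sub : (mu A + mu (A' `\` tube E (a * tau)) <= mu A')%E.
  rewrite [leRHS](measureDI mu mA' (measurable_tube (a * tau))) addeC leeD2l//.
  apply: measure_subset => //; first exact: measurableI.
  have tau1 : a * tau <= s.
    apply: le_trans taus; rewrite ler_pM2r// lerDl invr_ge0 exprn_ge0//.
    exact: ltW.
  move=> x [xE xx0]; split=> //; split; first exact: tubeS xE.
  by move: xx0; rewrite !in_ballE => /lt_le_trans; apply.
have fin B : measurable B -> B `<=` A' -> exists2 b, mu B = b%:E & 0 <= b.
  move=> mB BA'; have fB : mu B \is a fin_num.
    rewrite ge0_fin_numE//; apply: le_lt_trans (_ : mu (ball x0 rho) < +oo)%E.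
      by apply: measure_subset => // x /BA'[].
    by rewrite -ge0_fin_numE// (measure_ball_fin_num C_gt0 doublingC).
  by exists (fine (mu B)); rewrite ?fineK// fine_ge0.
have [a' a'E _] : exists2 b, mu A' = b%:E & 0 <= b by exact: fin.
have [b bE _] : exists2 b, mu (A' `\` tube E (a * tau)) = b%:E & 0 <= b.
  by apply: fin; [exact: measurableD|move=> x []].
have [g gE _] : exists2 b, mu A = b%:E & 0 <= b.
  apply: fin => // x Ax; apply: (radball x Ax); rewrite in_ballE mdistxx.
  by case: (radP x Ax).
move: step sub; rewrite a'E bE gE -EFinM -EFinD !lee_fin => step sub.
have K1 : 0 < 1 + K by rewrite addr_gt0.
rewrite mulrAC ler_pdivlMr//.
have : K * (g + b) <= K * a' by rewrite ler_pM2l.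
by lra.
Qed.

(* The radii [r (1 + 4 / 2 ^ k)] leave room at each step for the stopping balls, whose radii
   are at most [4 r / 2 ^ k] because [h] loses at most a factor [kap] per halving. *)
Lemma tube_decay : exists theta q D : R,
  [/\ 0 < theta < 1, 0 < q < 1, 0 < D &
    forall x0 r k, 0 < r ->
      (mu (tube E (a * (theta ^+ k * h x0 r)) `&` ball x0 r)
        <= (D * q ^+ k)%:E * mu (ball x0 r))%E].
Proof.
have [q [/andP[q0 q1] step]] := tube_decay_step.
(* This makes [(a + kap ^- 2) * theta <= a], so that the tube at level [k] serves as the large tube
   of the step to level [k.+1]. Taking [theta] as a power of [kap] allows exponents to be compared
   below. *)
have [p pP] : exists p, kap ^+ p.+1 <= a * kap ^+ 2 / 2.
  have e0 : 0 < a * kap ^+ 2 / 2 by rewrite divr_gt0// mulr_gt0 ?divr_gt0// exprn_gt0.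
  have : kap ^+ n @[n --> \oo] --> 0.
    by apply: cvg_expr; rewrite ger0_norm ?ltW//; case/andP: kap01.
  move=> /cvgrPdist_le/(_ _ e0)[n _ nP].
  exists n; have := nP n.+1 (leqnSn n); rewrite sub0r normrN ger0_norm//.
  by rewrite exprn_ge0// ltW.
have kap1 : kap < 1 by case/andP: kap01.
have delta1 : delta < 1 by case/andP: delta01.
set theta := kap ^+ p.+1 in pP.
have theta0 : 0 < theta by rewrite exprn_gt0.
have kap20 : 0 < kap ^+ 2 by rewrite exprn_gt0.
have kap21 : kap ^+ 2 < 1 by rewrite exprn_ilt1// ltW.
have ak : a * kap ^+ 2 < kap ^+ 2 by rewrite gtr_pMl//; lra.
have thetak : theta <= kap ^+ 2 by lra.
exists theta, q, (C ^+ 3); split.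
- by rewrite theta0 exprn_ilt1// ltW.
- by rewrite q0.
- by rewrite exprn_gt0.
move=> x0 r k r0; set H := h x0 r.
have H0 : 0 < H by exact: (maximal_hole_gt0 doublingC c_gt0 porousE).
pose G k := tube E (a * (theta ^+ k * H)) `&` ball x0 (r * (1 + 4 / 2 ^+ k)).
have GP : (mu (G k) <= (q ^+ k)%:E * mu (ball x0 (5 * r)))%E.
  elim: k => [|k IH].
    rewrite expr0 mul1e; apply: measure_subset => //; first exact: measurableI.
    by move=> x [_]; rewrite expr0 divr1 mulrC (_ : 1 + 4 = 5)//; lra.
  apply: (@le_trans _ _ (q%:E * mu (G k))%E); last first.
    by rewrite exprS EFinM -muleA lee_pmul2l.
  have pk0 : 0 < 2 ^+ k :> R by rewrite exprn_gt0.
  have tk0 : 0 < theta ^+ k by rewrite exprn_gt0.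
  apply: step.
  - by rewrite mulr_gt0// addr_gt0// divr_gt0.
  - by rewrite !mulr_gt0// exprn_gt0.
  - rewrite ler_pM2l// lerD2l ler_pM2l// lef_pV2 ?posrE ?exprn_gt0//.
    by rewrite exprS ler_pMl//; lra.
  - rewrite (exprS theta) -[theta * _ * H]mulrA mulrA ler_pM2r ?mulr_gt0// mulrDl.
    suff : kap ^- 2 * theta <= a / 2.
      have : a * theta <= a * (1 / 2) by rewrite ler_pM2l ?divr_gt0//; lra.
      by lra.
    by rewrite mulrC ler_pdivrMr//; lra.
  move=> x xE; rewrite in_ballE => xx0.
  have pk1 : 1 <= 2 ^+ k :> R by rewrite exprn_ege1//; lra.
  have x3 : ball x0 (3 * r) x.
    rewrite in_ballE; apply: lt_le_trans xx0 _; rewrite mulrC ler_pM2r//.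
    have : 4 / 2 ^+ k.+1 <= 2 :> R by rewrite ler_pdivrMr ?exprn_gt0// exprS; lra.
    by lra.
  have near := hole_near r0 x3.
  have tauh : 0 < theta ^+ k.+1 * H <= h x r.
    rewrite !mulr_gt0 ?exprn_gt0//=; apply: le_trans near.
    rewrite ler_pM2r// (exprS theta); apply: le_trans thetak; rewrite ger_pMr//.
    by rewrite exprn_ile1// ltW// exprn_ilt1// ltW.
  have [j [tauj jtau]] := stopping_scale r0 tauh.
  exists (r / 2 ^+ j); split=> //; first by rewrite divr_gt0// exprn_gt0.
  (* The hole at scale [j.+1] is at least [kap ^+ (j.+1 + 2) * H] but below [theta ^+ k.+1 * H];
     comparing powers of [kap] bounds [j] from below. Hence the stopping radius is at most
     [2 * r / 2 ^+ k], exactly the decrease of the radii in [G]. *)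
  have kj : (k.+1 <= j.+2)%N.
    have : kap ^+ (j.+1 + 2) * H < kap ^+ (p.+1 * k.+1) * H.
      rewrite (exprM kap p.+1); apply: le_lt_trans jtau.
      rewrite -mulrA -invfM -exprSr; apply: le_trans (hole_pow2 _ _ r0).
      by rewrite exprD -mulrA ler_pM2l// exprn_gt0.
    rewrite ltr_pM2r// => lt; have : (p.+1 * k.+1 < j.+1 + 2)%N.
      rewrite ltnNge; apply/negP => le; move: lt; apply/negP; rewrite -leNgt.
      by apply: ler_wiXn2l => //; exact: ltW.
    by rewrite mulSn addn2 !ltnS; exact/leq_trans/leq_addr.
  have : 2 ^+ k.+1 <= 2 ^+ j.+2 :> R by rewrite ler_eXn2l// ltr1n.
  rewrite !exprS => kj2.
  have pj0 : 0 < 2 ^+ j :> R by rewrite exprn_gt0.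
  have : r / 2 ^+ j <= r * (2 / 2 ^+ k).
    by rewrite ler_pM2l// ler_pdivlMr// mulrC ler_pdivrMr//; lra.
  by rewrite invfM; lra.
apply: le_trans (_ : mu (G k) <= _)%E.
  apply: measure_subset; [exact: measurableI|exact: measurableI|].
  move=> x [xE xx0]; split=> //; move: xx0; rewrite !in_ballE => /lt_le_trans; apply.
  by rewrite ler_pMr// lerDl divr_ge0// exprn_ge0.
apply: le_trans GP _; rewrite (mulrC (C ^+ 3)) EFinM -muleA lee_pmul2l ?lte_fin ?exprn_gt0//.
(* The initial ball of radius [5 * r] lies in the one of radius [2 ^+ 3 * r], whence [C ^+ 3]. *)
apply: le_trans (measure_ball_pow2 C_gt0 doublingC x0 3 r0).
by apply: measure_subset => //; apply: ball_subset; rewrite mdistxx; lra.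
Qed.

End tube_decay.

(** * Powers of the distance function *)

Section dist_negpow_weight.
Context {d : measure_display} {R : realType}.
Context {X : completeMetricMeasurableType d R}.
Variables (mu : {measure set X -> \bar R}).
Hypothesis open_measurable_set : forall U : set X, open U -> measurable U.
Variables (E : set X) (alpha : R).
Hypothesis alpha_gt0 : 0 < alpha.
Local Notation w := (dist_negpow E alpha).
Implicit Types (x : X) (s t : R).
Local Open Scope ereal_scope.

Let measurable_tube t : measurable (tube E t).
Proof. exact/open_measurable_set/tube_open. Qed.

Lemma dist_negpow_ge0 x : 0 <= w x.
Proof. by rewrite inve_ge0 poweR_ge0. Qed.

Lemma dist_negpow_le t x : (0 < t)%R -> ~ tube E t x -> w x <= (t `^ (- alpha))%:E.
Proof.
move=> t0 nt; have td : t%:E <= dist_set E x.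
  by rewrite leNgt; apply/negP => /dist_set_ltP.
rewrite powRN.
have -> : ((t `^ alpha)^-1)%:E = (t%:E `^ alpha)^-1.
  by rewrite poweR_EFin inver gt_eqF// powR_gt0.
rewrite lee_pV2 ?inE ?poweR_ge0//.
apply: gt0_ler_poweR; rewrite ?in_itv/= ?leey ?andbT//.
- exact: ltW.
- by rewrite lee_fin ltW.
- exact: dist_set_ge0.
Qed.

Lemma dist_negpow_ge t x : (0 < t)%R -> tube E t x -> (t `^ (- alpha))%:E <= w x.
Proof.
move=> t0 /dist_set_ltP/ltW td; rewrite powRN.
have -> : ((t `^ alpha)^-1)%:E = (t%:E `^ alpha)^-1.
  by rewrite poweR_EFin inver gt_eqF// powR_gt0.
rewrite lee_pV2 ?inE ?poweR_ge0//.
apply: gt0_ler_poweR; rewrite ?in_itv/= ?leey ?andbT//.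
- exact: ltW.
- exact: dist_set_ge0.
- by rewrite lee_fin ltW.
Qed.

Lemma measurable_dist_set : measurable_fun [set: X] (dist_set E).
Proof.
apply: (measurability _ (ErealGenCInfty.measurableE R)) => // _ [_ [t ->] <-].
rewrite setTI (_ : _ @^-1` _ = ~` tube E t); first exact: measurableC.
apply/seteqP; split => x /=; rewrite in_itv/= andbT.
  by move=> tx /dist_set_ltP; rewrite ltNge tx.
by move=> nt; rewrite leNgt; apply/negP => /dist_set_ltP.
Qed.

Lemma measurable_dist_negpow : measurable_fun [set: X] w.
Proof.
apply: (measurability _ (ErealGenOInfty.measurableE R)) => // _ [_ [t ->] <-].
rewrite setTI; have [t0|t0] := ltP t 0%R.
  rewrite (_ : _ @^-1` _ = setT)//; apply/seteqP; split => x //= _.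
  by rewrite in_itv/= andbT; apply: lt_le_trans (dist_negpow_ge0 x); rewrite lte_fin.
(* Inversion turns superlevel sets of the weight into sublevel sets of the power; at [t = 0] the
   threshold is [+oo]. *)
rewrite (_ : _ @^-1` _ =
    [set: X] `&` [set x | dist_set E x `^ alpha < (t%:E)^-1]).
  apply: emeasurable_fun_infty_o => //.
  exact: (measurableT_comp (measurable_poweR alpha) measurable_dist_set).
rewrite setTI; apply/seteqP; split => x /=; rewrite in_itv/= andbT;
  by rewrite inve_pgt ?inE ?lee_fin ?poweR_ge0.
Qed.

(** Layer by layer, the weight grows by the factor [theta ^ (- alpha)] (a real power) while the mass
    shrinks by [q], so the integral is dominated by a convergent geometric series. *)
Lemma integral_dist_negpow_le (B : set X) (m s theta q D : R) :
  measurable B -> mu B = m%:E -> (0 < s)%R -> (0 < theta < 1)%R ->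
  (0 < q)%R -> (0 < D)%R -> (theta `^ (- alpha) * q < 1)%R ->
  (forall k, mu (tube E (s * theta ^+ k) `&` B) <= (D * q ^+ k)%:E * mu B) ->
  \int[mu]_(x in B) w x <=
    ((1 + D / q) / (1 - theta `^ (- alpha) * q) * s `^ (- alpha))%:E * mu B.
Proof.
move=> mB mE s0 /andP[theta0 theta1] q0 D0 tq1 decay.
(* [w <= b j] outside [T j.+1], so the terms [b k * \1_(T k)] sum up to at least [w]; the
   sum diverges where [dist(., E) = 0]. *)
pose T k := if k is j.+1 then tube E (s * theta ^+ j)%R else [set: X].
have mT k : measurable (T k) by case: k => [|k]; [exact: measurableT|exact: measurable_tube].
pose b k := ((s * theta ^+ k) `^ (- alpha))%R.
have b0 k : (0 < b k)%R by rewrite powR_gt0// mulr_gt0// exprn_gt0.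
have bE k : b k = (s `^ (- alpha) * (theta `^ (- alpha)) ^+ k)%R.
  have th0 := ltW theta0; rewrite /b powRM ?(ltW s0) ?exprn_ge0//; congr (_ * _)%R.
  rewrite -(powR_mulrn k th0) -(powR_mulrn k (powR_ge0 theta (- alpha))) -!powRrM.
  by congr (theta `^ _)%R; rewrite mulrC.
have thetaV : (1 <= theta `^ (- alpha))%R.
  rewrite powRN invf_ge1 ?powR_gt0//.
  apply: (@le_trans _ _ (1 `^ alpha)%R); last by rewrite powR1.
  by apply: ge0_ler_powR; rewrite ?nnegrE ?ler01 ?ltW.
have f_ge0 k x : 0 <= (b k * \1_(T k) x)%:E.
  by rewrite lee_fin mulr_ge0// ltW.
have wle x : w x <= \sum_(0 <= k <oo) (b k * \1_(T k) x)%:E.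
  have [[k nk]|allk] := pselect (exists k, ~ T k x).
    (* The least index missing [x] is a successor [j.+1], because [T 0] is everything; the single
       term at [j] already dominates the weight. *)
    have ex : exists k, ~~ `[< T k x >] by exists k; apply/asboolP.
    have [[|j] /asboolP jn jmin] := ex_minnP ex; first by case: jn.
    have Tj : T j x.
      apply: contrapT => nTj; have /jmin : ~~ `[< T j x >] by exact/asboolP.
      by rewrite ltnn.
    apply: (@le_trans _ _ (b j)%:E).
      by apply: dist_negpow_le => //; rewrite mulr_gt0// exprn_gt0.
    apply: le_trans (nneseries_lim_ge j.+1 _) => //.
    rewrite big_nat_recr//= indicE mem_set// mulr1 leeDr//.
    by apply: sume_ge0 => i _; exact: f_ge0.
  rewrite (_ : \sum_(0 <= k <oo) _ = +oo) ?leey//.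
  apply/eqyP => A A0; have [n nA] : exists n, (A <= (b 0%N) *+ n)%R.
    exists (Num.bound (A / b 0%N)); rewrite -mulr_natr mulrC -ler_pdivrMr//.
    by rewrite ltW// archi_boundP// divr_ge0// ltW.
  apply: le_trans (nneseries_lim_ge n _) => //; apply: le_trans (_ : (b 0%N *+ n)%:E <= _).
    by rewrite lee_fin.
  elim: n {nA} => [|n IH]; first by rewrite big_nil.
  rewrite big_nat_recr//= mulrSr EFinD leeD//.
  have Tn : T n x by apply: contrapT => nTn; apply: allk; exists n.
  rewrite indicE mem_set// mulr1 lee_fin !bE ler_pM2l ?powR_gt0//.
  by rewrite expr0 exprn_ege1.
apply: (@le_trans _ _ (\int[mu]_(x in B) \sum_(0 <= k <oo) (b k * \1_(T k) x)%:E)).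
  apply: ge0_le_integral => //.
  - by move=> x _; exact: dist_negpow_ge0.
  - exact: measurable_funTS measurable_dist_negpow.
  - apply: ge0_emeasurable_sum => // k _.
    exact/measurable_EFinP/measurable_funM.
rewrite integral_nneseries//; last first.
  by move=> k; exact/measurable_EFinP/measurable_funM.
pose L := ((1 + D / q) * s `^ (- alpha) * m)%R.
have m0 : (0 <= m)%R by rewrite -lee_fin -mE.
(* The summand 1 accounts for the full layer [T 0], and the division by [q] for the index shift
   between [T k.+1] and [theta ^+ k]. *)
have DL k : mu (T k `&` B) <= ((1 + D / q) * q ^+ k * m)%:E.
  case: k => [|k].
    rewrite setTI mE lee_fin expr0 mulr1 ler_peMl// lerDl divr_ge0//; exact: ltW.
  apply: le_trans (decay k) _; rewrite mE -EFinM lee_fin ler_wpM2r//.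
  rewrite exprS mulrA ler_wpM2r ?exprn_ge0 ?(ltW q0)// mulrDl mul1r divfK ?gt_eqF//.
  by rewrite lerDr ltW.
apply: (@le_trans _ _ (\sum_(0 <= k <oo)
    (L * (theta `^ (- alpha) * q) ^+ k)%:E)).
  apply: lee_nneseries => [k _ _|k _]; first by apply: integral_ge0.
  rewrite (integralZl_indic mB (fun=> T k))//; last first.
    by move=> /(lt_trans (b0 k)); rewrite ltxx.
  rewrite integral_indic//; apply: le_trans (lee_wpmul2l _ (DL k)) _.
    by rewrite lee_fin ltW.
  rewrite -EFinM lee_fin bE exprMn /L le_eqVlt; apply/orP; left; apply/eqP; ring.
have L0 : (0 <= L)%R.
  by rewrite /L !mulr_ge0 ?powR_ge0// addr_ge0// divr_ge0// ltW.
have r0 : (0 < theta `^ (- alpha) * q)%R by rewrite mulr_gt0// powR_gt0.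
rewrite mE -EFinM; apply: lime_le.
  by apply: is_cvg_nneseries => k _ _; rewrite lee_fin mulr_ge0// exprn_ge0// ltW.
apply: nearW => n; rewrite sumEFin lee_fin.
apply: le_trans (geometric_le_lim n L0 r0 _) _; first by rewrite ger0_norm// ltW.
by rewrite /L le_eqVlt; apply/orP; left; apply/eqP; ring.
Qed.

End dist_negpow_weight.

(** The chosen exponent turns the power of [theta] into the inverse square root of [q], so the
    product is the square root of [q]. *)
Lemma exists_small_exponent (R : realType) (theta q : R) :
  0 < theta < 1 -> 0 < q < 1 ->
  exists alpha : R, 0 < alpha /\ theta `^ (- alpha) * q < 1.
Proof.
move=> /andP[t0 t1] /andP[q0 q1].
have lt : ln theta < 0 by apply: ln_lt0; rewrite t0.
have lq : ln q < 0 by apply: ln_lt0; rewrite q0.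
exists (ln q / (2 * ln theta)); split.
  by rewrite nmulr_rgt0// invr_lt0 pmulr_rlt0.
have lt0 : ln theta != 0 by rewrite lt_eqF.
have -> : theta `^ (- (ln q / (2 * ln theta))) = expR (- (ln q / 2)).
  by rewrite /powR gt_eqF//; congr expR; field.
rewrite -[X in _ * X](@lnK _ q) ?posrE// -expRD expR_lt1.
by move: lq; lra.
Qed.

(** * The equivalence *)

Section porous_to_A1.
Context {d : measure_display} {R : realType}.
Context {X : completeMetricMeasurableType d R}.
Variables (mu : {measure set X -> \bar R}) (C : R).
Hypothesis open_measurable_set : forall U : set X, open U -> measurable U.
Hypothesis C_gt0 : 0 < C.
Hypothesis doublingC : doubling_const mu C.
Implicit Types (E : set X) (x y z : X) (r s t : R).

(** A pointwise lower bound [M] is below the essential infimum, so the A1 inequality reduces to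
    comparing the integral with [M]. *)
Lemma A1_ball_bound (w : X -> \bar R) x r (K M : R) : 0 < r -> 0 <= K ->
  (\int[mu]_(y in ball x r) w y <= (K * M)%:E * mu (ball x r))%E ->
  (forall y, ball x r y -> (M%:E <= w y)%E) ->
  ((mu (ball x r))^-1 * \int[mu]_(y in ball x r) w y
     <= K%:E * ess_inf_on mu (ball x r) w)%E.
Proof.
move=> r0 K0 intw Mw.
have ballfin := measure_ball_fin_num C_gt0 doublingC x r0.
have := measure_ball_gt0 doublingC x r0; move: intw.
rewrite -(fineK ballfin); set m := fine _; rewrite lte_fin => intw m0.
rewrite inver gt_eqF// lee_pdivrMl//; apply: le_trans intw _.
rewrite muleC; apply: lee_wpmul2l; first by rewrite lee_fin ltW.
rewrite EFinM; apply: lee_wpmul2l; first by rewrite lee_fin.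
by apply: ereal_sup_ubound; apply: aeW.
Qed.

Lemma integral_le_cst (w : X -> \bar R) (B : set X) (M : R) :
  measurable B -> measurable_fun [set: X] w -> (forall x, (0 <= w x)%E) ->
  (forall x, B x -> (w x <= M%:E)%E) ->
  (\int[mu]_(x in B) w x <= M%:E * mu B)%E.
Proof.
move=> mB mw w0 wM; rewrite -integral_cst//; apply: ge0_le_integral => //.
exact: measurable_funTS.
Qed.

(** On balls whose center is within [2 * r] of [E], tube decay bounds the mean and the hole size
    bounds the distance to [E]. On the other balls the distance is either comparable to a constant
    or infinite. *)
Lemma porous_A1 E : annular_decay mu -> weakly_porous mu E ->
  exists alpha : R, 0 < alpha /\ muckenhoupt_A1 mu (dist_negpow E alpha).
Proof.
move=> ad [c [delta [/andP[c0 _] delta01 porousE]]].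
have delta0 : 0 < delta by case/andP: delta01.
have mball x r : measurable (ball x r) by exact: measurable_ball_metric.
have [kap [kap01 half]] :=
  hole_half open_measurable_set C_gt0 doublingC c0 delta0 porousE ad.
have [theta [q [D [theta01 q01 D0 decay]]]] := tube_decay
  open_measurable_set C_gt0 doublingC c0 delta01 kap01 porousE half.
have [kap0 kap1] := andP kap01; have [q0 q1] := andP q01.
have [alpha [alpha0 tq]] := exists_small_exponent theta01 q01.
exists alpha; split=> //; set w := dist_negpow E alpha.
have w0 x : (0 <= w x)%E by exact: dist_negpow_ge0.
have mw : measurable_fun [set: X] w by exact: measurable_dist_negpow.
pose L := (1 + D / q) / (1 - theta `^ (- alpha) * q).
have L0 : 0 <= L.
  by rewrite divr_ge0// ?subr_ge0 ?(ltW tq)// addr_ge0// divr_ge0// ltW.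
have intw x r : 0 < r -> (\int[mu]_(y in ball x r) w y <=
    (L * (delta / 2 * maximal_hole E x r) `^ (- alpha))%:E * mu (ball x r))%E.
  move=> r0; have ballfin := measure_ball_fin_num C_gt0 doublingC x r0.
  apply: (integral_dist_negpow_le (D := D) open_measurable_set alpha0 (mball x r)
    (esym (fineK ballfin)) _ theta01 q0 D0 tq).
    rewrite mulr_gt0 ?divr_gt0//.
    exact: (maximal_hole_gt0 doublingC c0 porousE).
  by move=> k; rewrite mulrAC -mulrA; exact: decay.
split.
  split=> // x; exists 1 => //; apply/integrableP; split.
    exact: measurable_funTS.
  under eq_integral do rewrite gee0_abs//.
  apply: le_lt_trans (intw x 1 ltr01) _.
  have := measure_ball_fin_num C_gt0 doublingC x (@ltr01 R).
  by move=> /fineK <-; rewrite -EFinM ltry.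
(* [K1] serves the balls near [E]: it absorbs the ratio between [delta / 2 * H] in the integral
   bound and the upper bound [4 * H / kap] for the distance. [K2] serves the balls far from [E]. *)
pose K1 := L * (delta * kap / 8) `^ (- alpha).
pose K2 := 4 `^ alpha : R.
have K10 : 0 <= K1 by rewrite mulr_ge0// powR_ge0.
have K20 : 0 <= K2 by rewrite powR_ge0.
exists (K1 + K2); split; first by rewrite addr_ge0.
move=> x0 r r0; set H := maximal_hole E x0 r.
have H0 : 0 < H by exact: (maximal_hole_gt0 doublingC c0 porousE).
have [x0E|x0E] := pselect (tube E (2 * r) x0).
  apply: (@A1_ball_bound _ _ _ _ ((4 * H / kap) `^ (- alpha))) => //.
  - by rewrite addr_ge0.
  - apply: le_trans (intw x0 r r0) _; apply: lee_wpmul2r => //.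
    rewrite lee_fin mulrDl -/H.
    have -> : delta / 2 * H = (delta * kap / 8) * (4 * H / kap).
      by field; rewrite gt_eqF.
    have dk : 0 <= delta * kap / 8 by rewrite divr_ge0// mulr_ge0// ltW.
    have Hk : 0 <= 4 * H / kap by rewrite divr_ge0 ?mulr_ge0// ltW.
    by rewrite powRM// mulrA lerDl mulr_ge0// powR_ge0.
  - move=> x xx0; apply: dist_negpow_ge => //; first by rewrite divr_gt0// mulr_gt0.
    (* If [x] were farther than [t] from [E], then [Num.min t r] would be a hole of the doubled
       ball, hence at most [H / kap < t]. So [r <= H / kap], and [x] is within [3 * r] of [E], a
       contradiction. *)
    apply: contrapT => /not_tubeP xE; set t := 4 * H / kap in xE.
    have t0 : 0 < t by rewrite divr_gt0// mulr_gt0.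
    have r2 : 0 < 2 * r by rewrite mulr_gt0.
    have mh : Num.min t r <= maximal_hole E x0 (2 * r).
      have mr : Num.min t r <= r by rewrite ge_min lexx orbT.
      apply: (@hole_ge _ _ _ _ _ x).
        by rewrite lt_min t0 r0/=; lra.
      move=> z xz; split.
        apply: (@ball_subset _ _ x0 x) xz; move: xx0; rewrite in_ballE; lra.
      apply: xE; move: xz; rewrite !in_ballE => /lt_le_trans; apply.
      by rewrite ge_min lexx.
    have Ht : H / kap < t by rewrite /t ltr_pM2r ?invr_gt0//; lra.
    have : Num.min t r <= H / kap.
      rewrite ler_pdivlMr// mulrC; apply: le_trans (_ : kap * maximal_hole E x0 (2 * r) <= _).
        by rewrite ler_pM2l.
      by apply: le_trans (half _ _ r2) _; rewrite mulrAC divff// mul1r.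
    rewrite ge_min leNgt Ht/= => rH.
    apply: (not_tubeP E t x).2 => //; apply: tubeS (tube_shift x x0E).
    have : t = 4 * (H / kap) by rewrite /t mulrA.
    move: xx0; rewrite in_ballE; lra.
have [Dy|[D' D'E]] : dist_set E x0 = +oo%E \/ exists D', dist_set E x0 = D'%:E.
  by have := dist_set_ge0 E x0; case: (dist_set E x0) => [D'|_|//]; [right; exists D'|left].
  have nt t x : ~ tube E t x.
    move=> /(tube_shift x0)/dist_set_ltP.
    by rewrite Dy.
  (* Here [E] is empty and the weight is the inverse of [+oo], that is 0 everywhere. *)
  apply: (@A1_ball_bound _ _ _ _ 0) => //; first by rewrite addr_ge0.
  rewrite mulr0; apply: integral_le_cst => // x _.
  suff -> : w x = 0%E by [].
  rewrite /w /dist_negpow (_ : dist_set E x = +oo%E).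
    by rewrite poweRyr ?gt_eqF// invey.
  have := dist_set_ge0 E x; case D'E: (dist_set E x) => [D'||]// _.
  by case: (nt (D' + 1) x); apply/dist_set_ltP; rewrite D'E lte_fin ltrDl.
(* Since [r <= D' / 2], the distance to [E] stays between [D' / 2] and [2 * D'] on the ball; the
   ratio 4 yields [K2]. *)
have D'r : 2 * r <= D'.
  by rewrite leNgt; apply/negP => ?; apply: x0E; apply/dist_set_ltP; rewrite D'E lte_fin.
have D'0 : 0 < D' by lra.
apply: (@A1_ball_bound _ _ _ _ ((2 * D') `^ (- alpha))) => //.
- by rewrite addr_ge0.
- apply: (@le_trans _ _ (((D' / 2) `^ (- alpha))%:E * mu (ball x0 r))%E).
    apply: integral_le_cst => // x xx0; apply: dist_negpow_le => //; first lra.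
    move=> /(tube_shift x0)/dist_set_ltP; rewrite D'E lte_fin metric_sym.
    by move: xx0; rewrite in_ballE; lra.
  apply: lee_wpmul2r => //; rewrite lee_fin mulrDl.
  have -> : (D' / 2) `^ (- alpha) = K2 * (2 * D') `^ (- alpha).
    rewrite (_ : 2 * D' = 4 * (D' / 2)); last by field.
    rewrite (@powRM R 4 (D' / 2)) ?divr_ge0 ?(ltW D'0)// mulrA (powRN 4) divff ?mul1r//.
    by rewrite gt_eqF// powR_gt0.
  by rewrite lerDr mulr_ge0// powR_ge0.
- move=> x xx0; apply: dist_negpow_ge => //; first lra.
  have : tube E (D' + r / 2) x0 by apply/dist_set_ltP; rewrite D'E lte_fin; lra.
  move=> /(tube_shift x); apply: tubeS; move: xx0; rewrite in_ballE; lra.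
Qed.

End porous_to_A1.

(** * From the A1 condition to weak porosity *)

Section A1_to_porous.
Context {d : measure_display} {R : realType}.
Context {X : completeMetricMeasurableType d R}.
Variables (mu : {measure set X -> \bar R}) (C : R).
Hypothesis open_measurable_set : forall U : set X, open U -> measurable U.
Hypothesis C_gt0 : 0 < C.
Hypothesis doublingC : doubling_const mu C.
Variables (E : set X) (alpha : R).
Hypothesis alpha_gt0 : 0 < alpha.
Implicit Types (x y z : X) (r s t : R).
Local Notation w := (dist_negpow E alpha).
Local Notation h := (maximal_hole E).

Let mball x r : measurable (ball x r).
Proof. exact: measurable_ball_metric. Qed.

Let mtube t : measurable (tube E t).
Proof. exact/open_measurable_set/tube_open. Qed.

(** A ball has positive measure, so it is not contained in a null set. *)
Lemma ae_ball_point (P : X -> Prop) x r : 0 < r -> (\forall z \ae mu, P z) ->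
  exists2 z, ball x r z & P z.
Proof.
move=> r0 [N [mN N0 PN]]; apply: contrapT => no.
have : (0 < mu (ball x r))%E := measure_ball_gt0 doublingC x r0.
rewrite ltNge => /negP; apply; rewrite -N0; apply: measure_subset => // z xz.
by apply: PN => Pz; apply: no; exists z.
Qed.

(** Local integrability gives a point [z] of the ball with finite weight. Without a hole, [z] would
    be at distance 0 from [E], where the weight is infinite. *)
Lemma weight_hole_gt0 x r : weight mu w -> 0 < r -> 0 < h x r.
Proof.
move=> [w0 mw /(_ x)[r1 r10 intw]] r0.
rewrite lt_neqAle hole_ge0 andbT; apply/negP => /eqP h0.
have m0 : 0 < Num.min r r1 by rewrite lt_min r0.
have [z xz wz] := ae_ball_point x m0 (integrable_ae (mball x r1) intw).
have {}wz : w z \is a fin_num.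
  apply: wz; move: xz; rewrite !in_ballE => /lt_le_trans; apply.
  by rewrite ge_min lexx orbT.
have xzr : mdist x z < r.
  by move: xz; rewrite in_ballE => /lt_le_trans; apply; rewrite ge_min lexx.
have tubez t : 0 < t -> tube E t z.
  move=> t0; apply: contrapT => /not_tubeP zt.
  have m1 : 0 < Num.min t (r - mdist x z) by rewrite lt_min t0 subr_gt0.
  have mr : Num.min t (r - mdist x z) <= r - mdist x z by rewrite ge_min lexx orbT.
  move: m1; apply/negP; rewrite -leNgt h0; apply: (@hole_ge _ _ _ _ _ z).
    rewrite lt_min t0 subr_gt0 xzr/=; have := mdist_ge0 x z; lra.
  move=> u zu; split; first by apply: (@ball_subset _ _ x z) zu; lra.
  apply: zt; move: zu; rewrite !in_ballE => /lt_le_trans; apply.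
  by rewrite ge_min lexx.
(* At distance [A] to the power [- alpha^-1] the weight is at least [A], which exceeds [w z]. *)
pose A := fine (w z) + 1.
have A0 : 0 < A by rewrite ltr_wpDl// fine_ge0.
have At : (A `^ (- alpha^-1)) `^ (- alpha) = A.
  by rewrite -powRrM mulrNN mulVf ?gt_eqF// powRr1// ltW.
have := dist_negpow_ge alpha_gt0 (powR_gt0 (- alpha^-1) A0) (tubez _ (powR_gt0 _ A0)).
by rewrite At -(fineK wz) lee_fin /A; lra.
Qed.

(** A Chebyshev estimate: the weight is at least [t] to the power [- alpha] on the tube, while a
    large hole keeps the essential infimum, and with it the mean, small. *)
Lemma A1_tube_le (C1 : R) x r t : weight mu w -> 0 <= C1 -> 0 < r -> 0 < t ->
  ((mu (ball x r))^-1 * \int[mu]_(y in ball x r) w y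
     <= C1%:E * ess_inf_on mu (ball x r) w)%E ->
  (mu (tube E t `&` ball x r) <=
     (C1 * (4 * t / h x r) `^ alpha)%:E * mu (ball x r))%E.
Proof.
move=> weightw C10 r0 t0 A1w; have h0 := weight_hole_gt0 x weightw r0.
have [w0 mw _] := weightw.
have ballfin := measure_ball_fin_num C_gt0 doublingC x r0.
have ess : (ess_inf_on mu (ball x r) w <= ((h x r / 4) `^ (- alpha))%:E)%E.
  apply: ge_ereal_sup => M Mw.
  (* The supremum need not be attained, so a hole of radius above [h x r / 2] is used. Points within
     [h x r / 4] of its center have distance at least [h x r / 4] from [E]. *)
  have [|y [s [hs sr ys]]] := @hole_gt _ _ _ E x r (h x r / 2).
    by apply/andP; split; lra.
  have h4 : 0 < h x r / 4 by lra.
  have [z yz Mz] := ae_ball_point y h4 Mw.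
  have zs : ball z (h x r / 4) `<=` ball y s.
    by apply: ball_subset; move: yz; rewrite in_ballE; lra.
  have [xz _] : (ball x r `\` E) z.
    by apply/ys/zs; rewrite in_ballE mdistxx.
  apply: le_trans (Mz xz) _; apply: dist_negpow_le => //.
  by apply/not_tubeP => u /zs/ys[].
have low : ((t `^ (- alpha))%:E * mu (tube E t `&` ball x r)
    <= \int[mu]_(y in ball x r) w y)%E.
  rewrite -integral_cst; last exact: measurableI.
  apply: le_trans (_ : \int[mu]_(y in tube E t `&` ball x r) w y <= _)%E.
    apply: ge0_le_integral => //; first exact: measurableI.
    - by move=> y _; rewrite lee_fin powR_ge0.
    - exact: measurable_funTS.
    - by move=> y [yt _]; exact: dist_negpow_ge.
  by apply: ge0_subset_integral => //; [exact: measurableI|exact: measurable_funTS].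
have m0 := measure_ball_gt0 doublingC x r0.
move: A1w low; move: ballfin m0 => /fineK <-; set m := fine _ => m0.
rewrite lte_fin in m0; rewrite inver gt_eqF// lee_pdivrMl// => A1w low.
have ta : 0 < t `^ (- alpha) by rewrite powR_gt0.
rewrite -(lee_pmul2l (x := (t `^ (- alpha))%:E))//.
apply: le_trans low _; apply: le_trans A1w _.
apply: (@le_trans _ _ (m%:E * (C1%:E * ((h x r / 4) `^ (- alpha))%:E))%E).
  apply: lee_wpmul2l; first by rewrite lee_fin ltW.
  by apply: lee_wpmul2l => //; rewrite lee_fin.
rewrite -!EFinM lee_fin le_eqVlt; apply/orP; left; apply/eqP.
have -> : 4 * t / h x r = t * (h x r / 4)^-1.
  by rewrite invf_div mulrCA mulrA.
have h4 : 0 < h x r / 4 by rewrite divr_gt0.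
rewrite (@powRM R t) ?invr_ge0 ?(ltW t0) ?(ltW h4)// (powRN t).
rewrite -(powR_inv1 (ltW h4)) -powRrM mulN1r; field.
by rewrite gt_eqF// powR_gt0.
Qed.

Lemma A1_porous : annular_decay mu -> muckenhoupt_A1 mu w -> weakly_porous mu E.
Proof.
move=> ad [weightw [C1 [C10 A1w]]].
have fin := measure_ball_fin_num C_gt0 doublingC.
have pos := measure_ball_gt0 doublingC.
have e0 : 0 < 4^-1 :> R by rewrite invr_gt0.
have [eps [/andP[eps0 eps1] ann]] := annular_decay_le fin pos ad e0.
(* [beta] is chosen so that the tube of width [beta * h x r] takes at most a quarter of the ball;
   [C1 + 1] avoids division by a vanishing [C1]. *)
have B0 : 0 < 4 * (C1 + 1) by lra.
pose beta := (4 * (C1 + 1)) `^ (- alpha^-1) / 4.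
have beta0 : 0 < beta by rewrite divr_gt0// powR_gt0.
have betaE : C1 * (4 * beta) `^ alpha <= 4^-1.
  rewrite /beta (mulrC 4 (_ / _)) divfK// -powRrM mulNr mulVf ?gt_eqF//.
  rewrite powR_inv1 ?(ltW B0)// ler_pdivrMr//; lra.
(* Half of the ball survives both removals and Vitali divides by [C ^+ 2]; the minimum with [2^-1]
   keeps the first constant below 1. In the second, [beta] keeps balls of radius [rho] off [E], and
   [eps / 2], with [h x r <= 2 * r], keeps them inside [ball x r]. *)
exists (Num.min 2^-1 (2^-1 / C ^+ 2)), (Num.min beta (eps / 2)); split.
- rewrite lt_min !gt_min divr_gt0 ?exprn_gt0//=.
  by apply/andP; split; [|apply/orP; left]; lra.
- by rewrite lt_min gt_min beta0/=; apply/andP; split; [|apply/orP; right]; lra.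
move=> x r r0; have h0 := weight_hole_gt0 x weightw r0.
set delta := Num.min _ _.
have delta0 : 0 < delta by rewrite lt_min beta0 divr_gt0.
have deltab : delta <= beta by rewrite ge_min lexx.
have deltae : delta <= eps / 2 by rewrite ge_min lexx orbT.
pose rho := delta * h x r.
have rho0 : 0 < rho by rewrite mulr_gt0.
have hr := hole_le E x (ltW r0).
have rhob : rho <= beta * h x r by rewrite ler_pM2r.
have rhoe : rho <= eps * r.
  apply: (@le_trans _ _ (eps / 2 * (2 * r))); last by lra.
  by apply: ler_pM => //; exact: ltW.
have er : eps * r < r by rewrite gtr_pMl.
pose r' := (1 - eps) * r.
have r'E : r' = r - eps * r by rewrite /r' mulrBl mul1r.
pose A := ball x r' `\` tube E (beta * h x r).
have mA : measurable A by exact: measurableD.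
have rhoball y : A y -> ball y rho `<=` ball x r `\` E.
  move=> [xy /not_tubeP yE] z yz; split.
    by apply: (@ball_subset _ _ x y) yz; move: xy; rewrite in_ballE; lra.
  by apply: yE; move: yz; rewrite !in_ballE => /lt_le_trans; exact.
(* The thin annulus and the tube each take at most a quarter of the mass. *)
have mAle : ((2^-1)%:E * mu (ball x r) <= mu A)%E.
  have tubele : (mu (tube E (beta * h x r) `&` ball x r) <= (4^-1)%:E * mu (ball x r))%E.
    apply: le_trans (A1_tube_le weightw C10 r0 _ (A1w x r r0)) _.
      by rewrite mulr_gt0.
    apply: lee_wpmul2r => //; rewrite lee_fin.
    by rewrite mulrA mulfK ?gt_eqF.
  have annx : (mu (ball x r `\` ball x r') < (4^-1)%:E * mu (ball x r))%E.
    by apply: ann => //; rewrite r'E; lra.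
  have r'r : ball x r' `<=` ball x r.
    by apply: ball_subset; rewrite mdistxx r'E; lra.
  have split1 : mu (ball x r) = (mu (ball x r `\` ball x r') + mu (ball x r'))%E.
    by rewrite (measureDI mu (mball x r) (mball x r')) (setIidr r'r).
  have split2 : mu (ball x r') =
      (mu A + mu (ball x r' `&` tube E (beta * h x r)))%E.
    exact: (measureDI mu (mball x r') (mtube (beta * h x r))).
  have tube2 : (mu (ball x r' `&` tube E (beta * h x r)) <=
      mu (tube E (beta * h x r) `&` ball x r))%E.
    by apply: measure_subset; [exact: measurableI|exact: measurableI|
                               move=> y [/r'r]].
  have finS B : measurable B -> B `<=` ball x r -> mu B \is a fin_num.
    move=> mB Bx; rewrite ge0_fin_numE//; apply: le_lt_trans (_ : mu (ball x r) < +oo)%E.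
      exact: measure_subset.
    by rewrite -ge0_fin_numE// fin.
  move: split1 split2 tubele annx tube2.
  have /fineK <- := finS (ball x r) (mball _ _) (@subset_refl _ _).
  have /fineK <- := finS (ball x r `\` ball x r')
    (measurableD (mball _ _) (mball _ _)) (@subDsetl _ _ _).
  have /fineK <- := finS (ball x r') (mball _ _) r'r.
  have /fineK <- : mu A \is a fin_num by apply: finS => // y [/r'r].
  have /fineK <- : mu (ball x r' `&` tube E (beta * h x r)) \is a fin_num.
    by apply: finS; [exact: measurableI|move=> y [/r'r]].
  have /fineK <- : mu (tube E (beta * h x r) `&` ball x r) \is a fin_num.
    by apply: finS; [exact: measurableI|move=> y []].
  rewrite -!EFinD -!EFinM !lee_fin !lte_fin => -[e1] -[e2]; lra.
have [y Ay|y /rhoball yr z /yr[]//|s [sA sd sc]] :=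
  doubling_vitali_cover open_measurable_set C_gt0 doublingC
    (x0 := x) (M := rho) (rad := fun=> rho) mA r0 rho0.
- by rewrite lexx.
exists (size s), (tnth (in_tuple s)), (fun=> rho).
have tA i : A (tnth (in_tuple s) i) by apply: sA; exact: mem_tnth.
split=> //.
- apply/trivIsetP => i j _ _ ij; apply/eqP/negPn/negP => /set0P[z [zi zj]].
  have /pairwiseP sdP := sd.
  wlog lt : i j ij zi zj / (i < j)%N.
    move=> wl; have [lt|gt|/val_inj ji] := ltngtP i j; first exact: (wl i j).
      by apply: (wl j i) => //; rewrite eq_sym.
    by rewrite ji eqxx in ij.
  have : disjoint_balls (fun=> rho) (nth x s i) (nth x s j).
    by apply: sdP => //; rewrite inE ltn_ord.
  rewrite /disjoint_balls => /asboolP.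
  by move: zi zj; rewrite !(tnth_nth x) /= => zi zj s0; have : set0 z by rewrite -s0.
- by move=> i; exact: rhoball.
- move=> i; rewrite lexx/=; apply: le_trans hr; rewrite ger_pMl//.
  apply: ltW; lra.
apply: (@le_trans _ _ ((2^-1 / C ^+ 2)%:E * mu (ball x r))%E).
  by apply: lee_wpmul2r => //; rewrite lee_fin ge_min lexx orbT.
rewrite mulrC EFinM -muleA lee_pdivrMl ?exprn_gt0//.
apply: le_trans mAle _; apply: le_trans sc _.
by rewrite big_tnth.
Qed.

End A1_to_porous.

Theorem theorem1p3 (d : measure_display) (R : realType)
    (X : completeMetricMeasurableType d R) (mu : {measure set X -> \bar R})
    (mu_complete : measure_is_complete mu)
    (mu_borel : borel_regular mu)
    (mu_doubling : doubling mu)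
    (mu_annular : annular_decay mu)
    (E : set X) :
  weakly_porous mu E <->
  exists alpha : R, 0 < alpha /\ muckenhoupt_A1 mu (dist_negpow E alpha).
Proof.
have [open_meas _] := mu_borel; have [C [C0 dbl]] := mu_doubling.
split=> [|[alpha [alpha0 A1w]]]; first exact: (porous_A1 open_meas C0 dbl).
exact: (A1_porous open_meas C0 dbl alpha0).
Qed.
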